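(* Let $\gamma>-1$ be a real number and let $\mathrm{W}(u,v,w)=u^{-1/2}v^{-1/2}(1-w)^{\gamma}$. For every integer $n\ge 0$ and all $r,s\in\{0,1,\dots,n\}$ with $r\ne s$, the polynomials $\mathscr{T}_{n,r}$ and $\mathscr{T}_{n,s}$ are orthogonal over $T$ with respect to the weight function $\mathrm{W}$; that is, $$\iint_T \mathscr{T}_{n,r}(u,v,w)\,\mathscr{T}_{n,s}(u,v,w)\,\mathrm{W}(u,v,w)\,dA=0.$$
   Context: $T=\{(u,v,w): u,v,w\ge 0,\ u+v+w=1\}$ is a (nondegenerate) triangle described in barycentric coordinates. With $\Delta>0$ denoting twice its area, integration over $T$ is given by $\iint_T f\,dA=\Delta\int_0^1\int_0^{1-w} f(u,1-u-w,w)\,du\,dw$. For integers $0\le i\le m$ write $B_i^m(x,y)=\binom{m}{i}x^i y^{m-i}$. For integers $n\ge 0$ and $0\le r\le n$ define $$\mathscr{T}_{n,r}(u,v,w)=\sum_{i=0}^{r}c(i)\,B_i^r(u,v)\ \sum_{j=0}^{n-r}(-1)^j\binom{n+r+1}{j}B_j^{n-r}(w,u+v),$$ where $$c(i)=(-1)^{r-i}\,\frac{\binom{2r}{r}\binom{2r}{2i}}{2^{2r}\binom{r}{i}},\qquad i=0,\dots,r.$$ *)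

(* Defs.v *)
From HB Require Import structures.
From mathcomp Require Import all_boot all_order all_algebra.
From mathcomp Require Import all_classical all_reals all_analysis.
Import Order.TTheory GRing.Theory Num.Theory.
Import numFieldNormedType.Exports.
Set Implicit Arguments.
Unset Strict Implicit.
Unset Printing Implicit Defensive.
Local Open Scope classical_set_scope.
Local Open Scope ring_scope.

Definition bernstein (R : realType) (m i : nat) (x y : R) : R :=
  'C(m, i)%:R * x ^+ i * y ^+ (m - i).

Definition cheb_coef (R : realType) (r i : nat) : R :=
  (-1) ^+ (r - i) * (('C(2 * r, r)%:R * 'C(2 * r, 2 * i)%:R)
                     / (2 ^+ (2 * r) * 'C(r, i)%:R)).

Definition triT (R : realType) (n r : nat) (u v w : R) : R :=
  \sum_(0 <= i < r.+1) cheb_coef R r i * bernstein r i u v *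
    (\sum_(0 <= j < (n - r).+1)
        (-1) ^+ j * 'C(n + r + 1, j)%:R * bernstein (n - r) j w (u + v)).

(* [0 `^ a = 0] for [a < 0]: the weight vanishes, instead of being infinite,
   on the edges where it is singular; these are null sets. *)
Definition weight (R : realType) (gamma u v w : R) : R :=
  u `^ (- (1 / 2)) * v `^ (- (1 / 2)) * (1 - w) `^ gamma.

(* Integral over a triangle of area [Delta / 2] of a function given in
   barycentric coordinates.  It is valued in the extended reals, where
   [+oo - oo = -oo], so that it cannot be finite by default when one of the
   positive and negative parts in the outer integral has infinite integral. *)
Definition iintT (R : realType) (Delta : R) (f : R -> R -> R -> R) : \bar R :=
  (Delta%:E * \int[lebesgue_measure]_(w in `[0%R, 1%R])
                \int[lebesgue_measure]_(u in `[0%R, (1 - w)%R])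
                  (f u (1 - u - w)%R w)%:E)%E.

(* Main.v *)
Require Import Defs.
From mathcomp Require Import all_boot all_order all_algebra.
From mathcomp Require Import all_classical all_reals all_analysis.
From mathcomp Require Import measurable_realfun ring lra zify.
Import Order.TTheory GRing.Theory Num.Theory.
Import numFieldNormedType.Exports.
Local Open Scope classical_set_scope.
Local Open Scope ring_scope.

(* On a line [w = const], put [L = 1 - w]: then [v = L - u], the factor of
   [T_{n,r}] involving [w] and [u + v = L] is constant, and what remains is a
   multiple of the Chebyshev polynomial of degree [r] shifted to [[0, L]].  It
   solves [u (L - u) p'' + (L / 2 - u) p' + r^2 p = 0], which is the
   Sturm-Liouville equation of the weight [u^(-1/2) (L - u)^(-1/2)].  Hence
   solutions with distinct eigenvalues [r^2] and [s^2] are orthogonal, and already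
   the inner integral over [u] vanishes for every [w]. *)

(** * The Chebyshev differential equation on [[0, L]], as polynomial identities *)

Definition mono {R : realType} (L : R) (i j : nat) : {poly R} :=
  'X^i * (L%:P - 'X) ^+ j.

Definition alt_bin {R : realType} (r i : nat) : R :=
  (-1) ^+ (r - i) * 'C(2 * r, 2 * i)%:R.

(* [chebp L r] is [Re (sqrt x + i sqrt (L - x)) ^ (2 r)], i.e. [L ^ r] times the
   Chebyshev polynomial [T_r] at [(2 x - L) / L]. *)
Definition chebp {R : realType} (L : R) (r : nat) : {poly R} :=
  \sum_(0 <= i < r.+1) alt_bin r i *: mono L i (r - i).

Lemma deriv_mono {R : realType} (L : R) i j :
  (mono L i j)^`() = mono L i.-1 j *+ i - mono L i j.-1 *+ j.
Proof.
by rewrite /mono derivM derivXn deriv_exp derivB derivC derivX sub0r; ring.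
Qed.

(* Twice the operator [x (L - x) p'' + (L / 2 - x) p' + lam p]; the factor avoids
   halves in [{poly R}]. *)
Definition cheb_op {R : realType} (L : R) (lam : nat) (p : {poly R}) : {poly R} :=
  2 * 'X * (L%:P - 'X) * p^`()^`() + (L%:P - 2 * 'X) * p^`() + 2 * lam%:R * p.

Lemma cheb_opZ {R : realType} (L : R) lam c p :
  cheb_op L lam (c *: p) = c *: cheb_op L lam p.
Proof. by rewrite /cheb_op !derivZ -!mul_polyC; ring. Qed.

(** With [V = L - X], the eigenvalue [(i + j)^2] gives [X^i V^j] the coefficient
    [i (2 i - 1) + j (2 j - 1)]. These are the coefficients of [X^(i-1) V^(j+1)] and
    [X^(i+1) V^(j-1)], so [X + V = L] factors out. *)
Lemma cheb_op_mono {R : realType} (L : R) i j :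
  cheb_op L ((i + j) ^ 2) (mono L i j) =
  L%:P * (i%:R * (2 * i%:R - 1) * mono L i.-1 j +
          j%:R * (2 * j%:R - 1) * mono L i j.-1).
Proof.
rewrite /cheb_op !(deriv_mono, derivB, derivMn) /mono.
(* [L] is eliminated as [V + X]; the case split then resolves the predecessors in the exponents. *)
move: (L%:P - 'X) (subrK 'X L%:P) => V <-.
by case: i => [|[|i]]; case: j => [|[|j]] /=; rewrite ?exprS; ring.
Qed.

(** Two steps along row [2 r] of Pascal's triangle, from column [2 i] to [2 i + 2], with a factor 2
    cancelled; the sign flips because [r - i] drops by one. *)
Lemma alt_bin_rec {R : realType} r i : (i < r)%N ->
  alt_bin r i.+1 * (i.+1%:R * (2 * i.+1%:R - 1)) =
  - (alt_bin r i * ((r - i)%:R * (2 * (r - i)%:R - 1))) :> R.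
Proof.
move=> ir; rewrite /alt_bin.
have -> : (r - i = (r - i.+1).+1)%N by lia.
rewrite exprS mulN1r !mulNr opprK -!mulrA; congr (_ * _).
have twoB k : 2 * k.+1%:R - 1 = (2 * k).+1%:R :> R by rewrite -!natr1 natrM; ring.
rewrite !twoB -!natrM; congr (_%:R).
have h1 := mul_bin_left (2 * r) (2 * i).
have h2 := mul_bin_left (2 * r) (2 * i).+1.
have e : (2 * i.+1 = (2 * i).+2)%N by lia.
rewrite e; nia.
Qed.

(** The image of the [i]-th summand is a combination of two neighbouring monomials of total degree
    [r - 1], and [alt_bin_rec] makes the sum telescope. *)
Lemma cheb_op_chebp {R : realType} (L : R) r : cheb_op L (r ^ 2) (chebp L r) = 0.
Proof.
have opD : {morph @cheb_op R L (r ^ 2) : p q / p + q}.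
  by move=> p q; rewrite /cheb_op !derivD; ring.
have op0 : cheb_op L (r ^ 2) 0 = 0 by rewrite /cheb_op !deriv0; ring.
rewrite /chebp (big_morph _ opD op0).
under eq_big_nat => i /andP[_ ir].
  rewrite cheb_opZ -[in (r ^ 2)%N](subnKC (ir : i <= r)%N) cheb_op_mono.
  rewrite -subnS (_ : _ *: _ = L%:P * (
    (alt_bin r i * (i%:R * (2 * i%:R - 1))) *: mono L i.-1 (r - i) +
    (alt_bin r i * ((r - i)%:R * (2 * (r - i)%:R - 1))) *: mono L i (r - i.+1))).
    over.
  rewrite -!mul_polyC !(polyCM, polyCB, polyC_natr); ring.
(* The first sum loses its term [i = 0] and the second its term [i = r], both zero; after the shift
   both run over [mono L i (r - i.+1)]. *)
rewrite -big_distrr /= big_split /= big_nat_recl // big_nat_recr //=.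
rewrite subnn !mul0r !mulr0 !scale0r add0r addr0 -big_split /=.
rewrite big_nat_cond big1 ?mulr0 // => i /andP[/andP[_ ir] _].
by rewrite alt_bin_rec // scaleNr addNr.
Qed.

(** * The fundamental theorem of calculus for integrands unbounded at the endpoints *)

Section ftc.
Context {R : realType}.
Notation mu := lebesgue_measure.

(** Starting at [k.+3] keeps each margin at most a third of the length, so that every closed
    interval is nondegenerate. *)
Lemma itv_oo_bigcup (a b : R) : a < b ->
  `]a, b[%classic = \bigcup_k `[a + (b - a) / k.+3%:R, b - (b - a) / k.+3%:R]%classic.
Proof.
move=> ab; apply/seteqP; split => x /=.
  rewrite in_itv /= => /andP[ax xb].
  have d0 : 0 < Num.min (x - a) (b - x) by rewrite lt_min !subr_gt0 ax.
  have : \forall k \near \oo, (b - a) / k.+3%:R <= Num.min (x - a) (b - x).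
    near=> k.
    rewrite ler_pdivrMr // -ler_pdivrMl // mulrC.
    apply: (@le_trans _ _ k%:R); last by rewrite ler_nat !leqW.
    by near: k; exact: nbhs_infty_ger.
  case=> N _ /(_ N (leqnn N)); rewrite le_min => /andP[h1 h2].
  exists N => //=; rewrite in_itv /=; apply/andP; split; first by rewrite -lerBrDl.
  by rewrite lerBrDr -lerBrDl.
case=> k _ /=; rewrite !in_itv /= => /andP[h1 h2].
have e0 : 0 < (b - a) / k.+3%:R by rewrite divr_gt0 // subr_gt0.
by rewrite (lt_le_trans _ h1) ?ltrDl // (le_lt_trans h2) ?gtrBl.
Unshelve. all: by end_near. Qed.

(** The usual theorem applies on the exhausting closed intervals. Monotone convergence handles the
    integrals, and one-sided continuity of [F] at [a] and [b] handles the boundary values. *)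
Lemma ge0_FTC2_oo (f F : R -> R) a b : a < b ->
  {in `]a, b[, forall x, 0 <= f x} ->
  {in `]a, b[, continuous f} ->
  derivable_oo_LRcontinuous F a b ->
  {in `]a, b[, F^`()%classic =1 f} ->
  (\int[mu]_(x in `]a, b[) (f x)%:E = (F b)%:E - (F a)%:E)%E.
Proof.
move=> ab f0 cf [dF Fa Fb] F'f.
pose e k : R := (b - a) / k.+3%:R.
have e0 k : 0 < e k by rewrite divr_gt0 // subr_gt0.
have e3 k : e k <= (b - a) / 3.
  by rewrite ler_pM2l ?subr_gt0 // lef_pV2 ?posrE // ler_nat.
have ecvg : e k @[k --> \oo] --> (0 : R).
  rewrite -(mulr0 (b - a)); apply: cvgMr.
  have := @cvg_harmonic R.
  by rewrite -(cvg_shiftn 2); under eq_fun do rewrite addn2.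
have sub k : `[a + e k, b - e k] `<=` `]a, b[.
  by rewrite itv_oo_bigcup // => x ?; exists k.
rewrite itv_oo_bigcup //.
pose A k : set (measurableTypeR R) := `[a + e k, b - e k]%classic.
have ndA : nondecreasing_seq A.
  move=> m n mn; rewrite subsetEset; apply: subset_itv; rewrite bnd_simp.
    by rewrite lerD2l ler_pM2l ?subr_gt0 // lef_pV2 ?posrE // ler_nat !ltnS.
  by rewrite lerB // ler_pM2l ?subr_gt0 // lef_pV2 ?posrE // ler_nat !ltnS.
have mA k : measurable (A k) by exact: measurable_itv.
have mf k : measurable_fun (A k) (EFin \o f).
  apply/measurable_EFinP; apply: measurable_funS (sub k) _ => //.
  by apply: open_continuous_measurable_fun => // x /[!inE]; exact: cf.
have fA0 k x : A k x -> (0 <= (EFin \o f) x)%E.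
  by move=> /sub xab; rewrite /= lee_fin; exact: f0.
have := ge0_nondecreasing_set_cvg_integral (mu := lebesgue_measure) ndA mA mf fA0.
move=> /cvg_unique; apply; first exact: ereal_hausdorff.
have -> : (fun k => \int[mu]_(x in A k) (f x)%:E)%E =
          (fun k => (F (b - e k) - F (a + e k))%:E).
  apply/funext => k; rewrite EFinB; apply: continuous_FTC2.
  - have := e3 k; have := e0 k; move=> *; lra.
  - by apply: continuous_in_subspaceT => x /[!inE] /sub; exact: cf.
  - have ekk : a + e k < b - e k by have := e3 k; have := e0 k; move=> *; lra.
    have : {within `[a + e k, b - e k], continuous F}.
      by apply: derivable_within_continuous => x /sub; exact: dF.
    move/(continuous_within_itvP _ ekk) => [_ ? ?]; split => // x.
    by move=> /subset_itv_oo_cc /sub; exact: dF.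
  - by move=> x /subset_itv_oo_cc /sub; exact: F'f.
rewrite -EFinB; apply: cvg_EFin; first exact: nearW.
apply: cvgB.
- apply: ((cvg_at_leftP F b (F b)).1 Fb) => /=; split => //.
    by move=> k; rewrite gtrBl.
  rewrite -[X in _ --> X]subr0; apply: cvgB => //; exact: cvg_cst.
- apply: ((cvg_at_rightP F a (F a)).1 Fa) => /=; split => //.
    by move=> k; rewrite ltrDl.
  rewrite -[X in _ --> X]addr0; apply: cvgD => //; exact: cvg_cst.
Qed.

(* Applied to [f + g >= 0] and [g >= 0], the nonnegative case gives both integrals. *)
Lemma dominated_FTC2 (f F g G : R -> R) a b : a < b ->
  {in `]a, b[, forall x, `|f x| <= g x} ->
  {in `]a, b[, continuous f} -> {in `]a, b[, continuous g} ->
  derivable_oo_LRcontinuous F a b -> derivable_oo_LRcontinuous G a b ->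
  {in `]a, b[, F^`()%classic =1 f} -> {in `]a, b[, G^`()%classic =1 g} ->
  (\int[mu]_(x in `[a, b]) (f x)%:E = (F b)%:E - (F a)%:E)%E.
Proof.
move=> ab fg cf cg dF dG F'f G'g.
have mf : measurable_fun `]a, b[%classic f.
  by apply: open_continuous_measurable_fun => // x /[!inE]; exact: cf.
have mg : measurable_fun `]a, b[%classic g.
  by apply: open_continuous_measurable_fun => // x /[!inE]; exact: cg.
rewrite integral_itv_bndoo; last exact/measurable_EFinP.
have g0 : {in `]a, b[, forall x, 0 <= g x}.
  by move=> x /fg; apply: le_trans.
have intg : (\int[mu]_(x in `]a, b[) (g x)%:E = (G b)%:E - (G a)%:E)%E.
  exact: ge0_FTC2_oo.
have ig : mu.-integrable `]a, b[%classic (EFin \o g).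
  apply/integrableP; split; first exact/measurable_EFinP.
  under eq_integral => x /[!inE] /g0 g0x do rewrite /= ger0_norm //.
  by rewrite intg -EFinB ltry.
have intfg : (\int[mu]_(x in `]a, b[) (f x + g x)%:E =
    (F b + G b)%:E - (F a + G a)%:E)%E.
  apply: (@ge0_FTC2_oo _ (F \+ G)) => //.
  - move=> x xab; have := fg _ xab; rewrite ler_norml => /andP[? _]; lra.
  - by move=> x xab; apply: cvgD; [exact: cf|exact: cg].
  - case: dF dG => dF Fa Fb [dG Ga Gb]; split.
    + by move=> x xab; apply: derivableD; [exact: dF|exact: dG].
    + exact: cvgD.
    + exact: cvgD.
  - case: dF dG => dF _ _ [dG _ _] x xab.
    rewrite derive1E deriveD; [|exact: dF|exact: dG].
    by rewrite -!derive1E F'f // G'g.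
have if_ : mu.-integrable `]a, b[%classic (EFin \o f).
  apply: (le_integrable _ _ _ ig) => //; first exact/measurable_EFinP.
  by move=> x xab /=; rewrite lee_fin (ger0_norm (g0 _ xab)) fg.
have := intfg; under eq_integral do rewrite EFinD.
rewrite integralD // intg.
(* Finiteness of the integral of [f] lets the integral of [g] be subtracted in the reals. *)
have /fineK <- : (\int[mu]_(x in `]a, b[) (f x)%:E \is a fin_num)%E.
  by apply: (integrable_fin_num _ if_).
by rewrite -!EFinB -EFinD => -[h]; congr EFin; lra.
Qed.

End ftc.

(** * Sturm-Liouville orthogonality for the Chebyshev weight *)

Lemma is_derive_sqrtB {R : realType} (L x : R) : x < L ->
  is_derive x 1 (fun y => Num.sqrt (L - y)) (- (2 * Num.sqrt (L - x))^-1).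
Proof.
move=> xL; rewrite -mulrN1.
have d1 : is_derive (L - x) 1 Num.sqrt (2 * Num.sqrt (L - x))^-1.
  by apply: is_derive1_sqrt; rewrite subr_gt0.
have d2 : is_derive x 1 (fun y => L - y) (- 1 : R).
  by apply: is_derive_eq; rewrite add0r mul1r.
exact: (@is_derive1_comp _ Num.sqrt (fun y => L - y)).
Qed.

Lemma continuous_sqrtB {R : realType} (L : R) :
  continuous (fun y => Num.sqrt (L - y)).
Proof.
move=> x; apply: (@continuous_comp _ _ _ (fun y => L - y) Num.sqrt).
  by apply: cvgB; [exact: cvg_cst|exact: cvg_id].
exact: sqrt_continuous.
Qed.

(** Clearing denominators leaves [sqrt (x + y) <= sqrt x + sqrt y]. With [x + y = L] this bounds the
    weight by a function with an elementary primitive. *)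
Lemma inv_sqrtM_le {R : realType} (x y : R) : 0 < x -> 0 < y ->
  (Num.sqrt x * Num.sqrt y)^-1 <=
  ((Num.sqrt x)^-1 + (Num.sqrt y)^-1) / Num.sqrt (x + y).
Proof.
move=> x0 y0; have sx : 0 < Num.sqrt x by rewrite sqrtr_gt0.
have sy : 0 < Num.sqrt y by rewrite sqrtr_gt0.
have sxy : 0 < Num.sqrt (x + y) by rewrite sqrtr_gt0 addr_gt0.
rewrite ler_pdivlMr // mulrC ler_pdivrMr ?mulr_gt0 //.
have -> : ((Num.sqrt x)^-1 + (Num.sqrt y)^-1) * (Num.sqrt x * Num.sqrt y) =
          Num.sqrt x + Num.sqrt y by field; rewrite !gt_eqF.
rewrite -(@ler_pXn2r _ 2) ?nnegrE ?addr_ge0 ?(ltW sx) ?(ltW sy) ?(ltW sxy) //.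
rewrite sqrrD !sqr_sqrtr ?(ltW (addr_gt0 x0 y0)) ?(ltW x0) ?(ltW y0) //.
by rewrite addrAC lerDl mulrn_wge0 ?mulr_ge0 ?(ltW sx) ?(ltW sy).
Qed.

(* [sqrt (x (L - x)) (p' q - p q')] vanishes at [0] and [L], and its derivative is
   [(b - a) p q / sqrt (x (L - x))]. *)
Lemma cheb_op_orthogonal {R : realType} (L : R) (a b : nat) (p q : {poly R}) :
  0 < L -> a != b -> cheb_op L a p = 0 -> cheb_op L b q = 0 ->
  (\int[lebesgue_measure]_(x in `[0%R, L])
     (p.[x] * q.[x] / (Num.sqrt x * Num.sqrt (L - x)))%R%:E = 0)%E.
Proof.
move=> L0 ab hp hq.
have ba0 : b%:R - a%:R != 0 :> R by rewrite subr_eq0 eqr_nat eq_sym.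
pose W : {poly R} := (b%:R - a%:R)^-1 *: (p^`() * q - p * q^`()).
pose F x : R := Num.sqrt x * Num.sqrt (L - x) * W.[x].
have cabs : {within `[0, L]%classic, continuous (fun x => `|(p * q).[x]|)}.
  apply: continuous_subspaceT => x.
  by apply: cvg_norm; exact: continuous_horner.
have [c _ cmax] := EVT_max (ltW L0) cabs.
set B : R := `|(p * q).[c]| in cmax.
(* [B] bounds [|p q|] on [[0, L]], so [inv_sqrtM_le] makes [g] dominate the integrand; [G] is a
   primitive of [g]. *)
pose C : R := B / Num.sqrt L.
pose g x : R := C * ((Num.sqrt x)^-1 + (Num.sqrt (L - x))^-1).
pose G x : R := C * (2 * Num.sqrt x - 2 * Num.sqrt (L - x)).
have sqrt0L x : x \in `]0, L[ -> 0 < Num.sqrt x /\ 0 < Num.sqrt (L - x).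
  by rewrite in_itv /= => /andP[? ?]; rewrite !sqrtr_gt0 subr_gt0.
have dF x : x \in `]0, L[ ->
    is_derive x 1 F (p.[x] * q.[x] / (Num.sqrt x * Num.sqrt (L - x))).
  move=> xL; have [sx sy] := sqrt0L x xL.
  move: xL; rewrite in_itv /= => /andP[x0 xL].
  have d1 := is_derive1_sqrt x0.
  have d2 := is_derive_sqrtB _ _ xL.
  have d3 := is_derive_poly W x.
  apply: is_derive_eq.
  have hpx := congr1 (horner^~ x) hp; have hqx := congr1 (horner^~ x) hq.
  move: hpx hqx; rewrite /cheb_op /= !(hornerMn, hornerE) => hpx hqx.
  rewrite /W derivZ derivB !derivM !hornerE /= /GRing.scale /=.
  have ex := sqr_sqrtr (ltW x0).
  have ey : Num.sqrt (L - x) ^+ 2 = L - x by rewrite sqr_sqrtr // subr_ge0 ltW.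
  move: (Num.sqrt x) (Num.sqrt (L - x)) p.[x] q.[x] p^`().[x] q^`().[x]
    p^`()^`().[x] q^`()^`().[x] sx sy ex ey hpx hqx
    => u v P Q P1 Q1 P2 Q2 u0 v0 ex ey hpx hqx.
  (* The differential equations are solved for the second derivatives, with [x = u^2] and
     [L - x = v^2]; the claim becomes a rational identity. *)
  have eP2 : P2 = - ((v ^+ 2 - u ^+ 2) * P1 + 2 * a%:R * P) / (2 * u ^+ 2 * v ^+ 2).
    apply: (canRL (mulfK _)); first by rewrite !mulf_neq0 ?expf_neq0 ?gt_eqF.
    rewrite ex ey; apply/eqP; rewrite -addr_eq0 -hpx; apply/eqP; ring.
  have eQ2 : Q2 = - ((v ^+ 2 - u ^+ 2) * Q1 + 2 * b%:R * Q) / (2 * u ^+ 2 * v ^+ 2).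
    apply: (canRL (mulfK _)); first by rewrite !mulf_neq0 ?expf_neq0 ?gt_eqF.
    rewrite ex ey; apply/eqP; rewrite -addr_eq0 -hqx; apply/eqP; ring.
  rewrite eP2 eQ2; field; rewrite ba0 !gt_eqF //.
have cF : continuous F.
  move=> x; apply: cvgM; last exact: continuous_horner.
  by apply: cvgM; [exact: sqrt_continuous|exact: continuous_sqrtB].
have dG x : x \in `]0, L[ -> is_derive x 1 G (g x).
  move=> xL; have [sx sy] := sqrt0L x xL.
  move: xL; rewrite in_itv /= => /andP[x0 xL].
  have d1 := is_derive1_sqrt x0.
  have d2 := is_derive_sqrtB _ _ xL.
  apply: is_derive_eq.
  rewrite /g /GRing.scale /=; field; rewrite !gt_eqF //.
have cG : continuous G.
  move=> x; apply: cvgM; first exact: cvg_cst.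
  apply: cvgB; (apply: cvgM; first exact: cvg_cst).
    exact: sqrt_continuous.
  exact: continuous_sqrtB.
have LR H h : (forall x, x \in `]0, L[ -> is_derive x 1 H (h x : R)) ->
    continuous H -> derivable_oo_LRcontinuous H 0 L.
  move=> dH cH; split; first by move=> x /dH [].
    exact/cvg_at_right_filter/cH.
  exact/cvg_at_left_filter/cH.
transitivity ((F L)%:E - (F 0)%:E)%E; last first.
  by rewrite /F subrr sqrtr0 mulr0 !mul0r subee.
apply: (@dominated_FTC2 _ _ F g G) => //.
- move=> x xL; have [sx sy] := sqrt0L x xL.
  have sxy : 0 < (Num.sqrt x * Num.sqrt (L - x))^-1 by rewrite invr_gt0 mulr_gt0.
  rewrite normrM (gtr0_norm sxy).
  apply: (@le_trans _ _ (B / (Num.sqrt x * Num.sqrt (L - x)))).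
    rewrite ler_pM2r // -hornerM.
    by apply: cmax; exact: subset_itv_oo_cc.
  rewrite /g /C -mulrA; apply: ler_wpM2l; first exact: normr_ge0.
  rewrite [X in _ <= X]mulrC.
  have /andP[x0 xltL] : (0 < x) && (x < L) by move: xL; rewrite in_itv.
  have := inv_sqrtM_le _ _ x0 (_ : 0 < L - x).
  by rewrite subrKC; apply; rewrite subr_gt0.
- move=> x xL; have [sx sy] := sqrt0L x xL.
  apply: cvgM; first by apply: cvgM; exact: continuous_horner.
  apply: cvgV; first by rewrite mulf_neq0 // gt_eqF.
  by apply: cvgM; [exact: sqrt_continuous|exact: continuous_sqrtB].
- move=> x xL; have [sx sy] := sqrt0L x xL.
  apply: cvgM; first exact: cvg_cst.
  apply: cvgD; (apply: cvgV; first by rewrite gt_eqF).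
    exact: sqrt_continuous.
  exact: continuous_sqrtB.
- exact: LR dF cF.
- exact: LR dG cG.
- by move=> x /dF dx; rewrite derive1E; exact: derive_val.
- by move=> x /dG dx; rewrite derive1E; exact: derive_val.
Qed.

(** * From the triangle to the line [w = const] *)

(** The [C(r, i)] of the Bernstein polynomial cancels the one in the denominator of [cheb_coef],
    leaving [alt_bin r i] up to a factor independent of [i]. *)
Lemma triT_chebp {R : realType} n r (w : R) : exists K : R, forall u,
  triT n r u (1 - u - w) w = K * (chebp (1 - w) r).[u].
Proof.
exists ('C(2 * r, r)%:R / 2 ^+ (2 * r) *
  \sum_(0 <= j < (n - r).+1)
    (-1) ^+ j * 'C(n + r + 1, j)%:R * bernstein (n - r) j w (1 - w)) => u.
have uv : u + (1 - u - w) = 1 - w by ring.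
rewrite /triT uv -big_distrl /= mulrAC; congr (_ * _).
rewrite /chebp horner_sum big_distrr /=.
apply: eq_big_nat => i /andP[_ ir].
have C0 : 'C(r, i)%:R != 0 :> R by rewrite pnatr_eq0 -lt0n bin_gt0.
have two0 : 2 ^+ (2 * r) != 0 :> R by rewrite expf_neq0 // pnatr_eq0.
rewrite /cheb_coef /bernstein /alt_bin /mono !hornerE.
have -> : 1 - u - w = 1 - w - u by ring.
by rewrite /=; field; rewrite C0 two0.
Qed.

(** At [x = 0] both sides are 0 by convention, so the endpoints of the inner integral are covered
    too. *)
Lemma powRN12 {R : realType} (x : R) : 0 <= x -> x `^ (- (1 / 2)) = (Num.sqrt x)^-1.
Proof. by move=> x0; rewrite powRN div1r powR12_sqrt. Qed.

Theorem theorem2p3 (R : realType) (Delta gamma : R) (n r s : nat) :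
  0 < Delta -> -1 < gamma -> (r <= n)%N -> (s <= n)%N -> r <> s ->
  iintT Delta (fun u v w => triT n r u v w * triT n s u v w * weight gamma u v w)
    = 0%E.
Proof.
move=> _ _ _ _ rs; rewrite /iintT integral0_eq ?mule0 // => w /=.
(* At [w = 1] the inner interval is the single point 0, which is a null set. *)
rewrite in_itv /= => /andP[_]; rewrite le_eqVlt => /predU1P[->|w1].
  by rewrite subrr set_itv1 integral_set1.
have [K EK] := @triT_chebp R n r w; have [M EM] := @triT_chebp R n s w.
(* All factors independent of [u] are absorbed into the first polynomial, which still solves its
   equation by linearity. *)
pose k := K * M * (1 - w) `^ gamma.
have L0 : 0 < 1 - w by rewrite subr_gt0.
have op0 : cheb_op (1 - w) (r ^ 2) (k *: chebp (1 - w) r) = 0.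
  by rewrite cheb_opZ cheb_op_chebp scaler0.
rewrite -[RHS](cheb_op_orthogonal _ _ _ _ _ L0 _ op0 (cheb_op_chebp (1 - w) s)).
  apply: eq_integral => u; rewrite inE /= in_itv /= => /andP[u0 uL].
  rewrite EK EM (_ : 1 - u - w = 1 - w - u); last by ring.
  congr EFin; rewrite /weight !powRN12 ?subr_ge0 // hornerZ invfM /k; ring.
by rewrite eqn_exp2r //; apply/eqP.
Qed.
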